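(* Let $S$ be the set containing 24 copies of each odd positive integer, and let $T$ be the set containing 24 copies of each even positive integer. Let $D_S(N)$ be the number of partitions of $N$ into an odd number of distinct elements of $S$, and let $D_T(N)$ be the number of partitions of $N$ into distinct elements of $T$ (with no restriction on the number of parts). Then, for every integer $N\geq 3$, $$D_S(N)=2048\,D_T(N-3).$$
   Context: A ''set containing several copies'' of certain integers means a set of colored integers: the different copies of the same integer are regarded as distinct (distinguishable) elements, each having that integer as its value. A partition of $N$ into distinct elements of $X$ is a finite subset of $X$ whose elements have values summing to $N$ (so each copy is used at most once, but different copies of the same integer may be used together, and subsets using different copies are counted as different); the number of parts is the cardinality of this subset. The empty partition is the unique partition of $0$ when no restriction on the number of parts is imposed. *)

(* Defs.v *)
From mathcomp Require Import all_boot finmap.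
From mathcomp Require Import boolp classical_sets functions cardinality.

Set Implicit Arguments.
Unset Strict Implicit.
Unset Printing Implicit Defensive.

Local Open Scope classical_set_scope.

(** The pair [(c, v)] is the copy of the integer [v] that has color [c]. *)
Notation colored_nat := ('I_24 * nat)%type.

Definition odd_copies : set colored_nat := [set x | odd x.2].

Definition even_copies : set colored_nat := [set x | 0 < x.2 /\ ~~ odd x.2].

Definition distinct_partitions (X : set colored_nat) (N : nat) :
    set {fset colored_nat} :=
  [set A : {fset colored_nat} | [set` A] `<=` X /\ \sum_(x <- A) x.2 = N].

(** [fset_set] sends an infinite set to [fset0]; by the next lemma this does not
    happen in the definitions of [D_S] and [D_T]. *)
Lemma finite_distinct_partitions (X : set colored_nat) (N : nat) :
  finite_set (distinct_partitions X N).
Proof.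
pose B := seq_fset tt [seq (c, v) | c <- enum 'I_24, v <- iota 0 N.+1].
apply: (@sub_finite_set _ _ [set` fpowerset B]); last exact: finite_fset.
move=> A [_ sumA] /=; rewrite fpowersetE; apply/fsubsetP => -[c v] cvA.
rewrite seq_fsetE; apply/allpairsP; exists (c, v); split => //.
  by rewrite mem_enum.
have -> : (v \in iota 0 N.+1) = (v < N.+1) by rewrite mem_iota.
rewrite ltnS -sumA.
by rewrite (big_fsetD1 _ cvA) /= leq_addr.
Qed.

Definition D_S (N : nat) : nat :=
  #|` fset_set [set A | distinct_partitions odd_copies N A /\ odd #|` A|] |.

Definition D_T (N : nat) : nat :=
  #|` fset_set (distinct_partitions even_copies N) |.

(* Main.v *)
Require Import Defs.
From mathcomp Require Import all_boot.
From mathcomp Require Import all_algebra finmap.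
From mathcomp Require Import boolp classical_sets functions cardinality.
From mathcomp Require Import ring zify.
From Stdlib Require Import Setoid Morphisms.

(** Write [A], [B], [C], [E] for the products over [i >= 0] of
    [1 + q^(2i+1)], [1 - q^(2i+1)], [1 + q^(2i+2)], [1 - q^(2i+2)].  Expanding
    products over subsets of the colored integers, the coefficients of
    [(A^24 - B^24) / 2] count the partitions into an odd number of elements of
    [S], and those of [C^24] count the partitions into elements of [T].  The
    theorem therefore says that
      [A^24 - B^24 = 48 q + 4096 q^3 C^24],
    the term [48 q] being invisible from [q^3] on ([product_identity]).

    This is the cube of Jacobi's aequatio identica satis abstrusa
      [A^8 = B^8 + 16 q C^8]  ([jacobi_aequatio]):
    from [x = y + z] follows [x^3 = y^3 + z^3 + 3 x y z], and here
    [x y z = 16 q (A B C)^8 = 16 q] because of Euler's [A B C = 1]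
    ([euler_product]).

    Jacobi's identity is proved through the theta series
      [phi(q) = A^2 E],  [phi(-q) = B^2 E],  [psi(q^2) = C^2 E].
    The triple product, obtained as a limit of the q-binomial theorem, gives
    their expansions: [phi(q)] is the sum of [q^(k^2)] over all integers [k],
    and [psi(q^2)] the sum of [q^(k(k+1))] over [k >= 0]
    ([theta_product], [oblong_product]).  Separating even and odd [k] yields
      [phi(q) + phi(-q) = 2 phi(q^4)]  and  [phi(q) - phi(-q) = 4 q psi(q^8)],
    while the products alone yield
      [phi(q) phi(-q) = phi(-q^2)^2]  and  [phi(q^2) psi(q^4) = psi(q^2)^2].
    The one missing relation, [phi(q)^2 + phi(-q)^2 = 2 phi(q^2)^2], comes
    without counting lattice points: by the relations above, the difference
    [D(q)] of its two sides satisfies [D(q) = -2 D(q^2)], which forces [D = 0]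
    ([phi_sqrD]).  Then
      [phi(q)^4 - phi(-q)^4
         = (phi(q)^2 + phi(-q)^2) (phi(q) + phi(-q)) (phi(q) - phi(-q))]
    equals [16 q psi(q^2)^4], and dividing by [E^4] gives Jacobi's identity.

    Power series are represented by integer polynomials modulo [X^M]: the
    infinite products are cut off after [M] factors, and [congX M] is the
    congruence modulo [X^M]. *)

Set Implicit Arguments.
Unset Strict Implicit.
Unset Printing Implicit Defensive.

Import GRing.Theory.

(** * Polynomials modulo a power of X *)

Section Congruence.
Local Open Scope ring_scope.
Variable R : comNzRingType.
Implicit Types (p q r s u : {poly R}) (M : nat).

Definition congX M p q := exists r, p = q + r * 'X^M.

Lemma congX_refl M p : congX M p p.
Proof. by exists 0; rewrite mul0r addr0. Qed.

Lemma congX_sym M p q : congX M p q -> congX M q p.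
Proof. by case=> r ->; exists (- r); ring. Qed.

Lemma congX_trans M p q r : congX M p q -> congX M q r -> congX M p r.
Proof. by case=> u -> [v ->]; exists (u + v); ring. Qed.

Lemma congX_le M N p q : (N <= M)%N -> congX M p q -> congX N p q.
Proof.
by move=> leNM [r ->]; exists (r * 'X^(M - N)); rewrite -mulrA -exprD subnK.
Qed.

Lemma congXD M p q r s : congX M p q -> congX M r s -> congX M (p + r) (q + s).
Proof. by case=> u -> [v ->]; exists (u + v); ring. Qed.

Lemma congXN M p q : congX M p q -> congX M (- p) (- q).
Proof. by case=> u ->; exists (- u); ring. Qed.

Lemma congXM M p q r s : congX M p q -> congX M r s -> congX M (p * r) (q * s).
Proof.
by case=> u -> [v ->]; exists (u * s + q * v + u * v * 'X^M); ring.
Qed.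

Lemma congX_exp M p q k : congX M p q -> congX M (p ^+ k) (q ^+ k).
Proof.
move=> pq; elim: k => [|k IHk]; first exact: congX_refl.
by rewrite !exprS; apply: congXM.
Qed.

Lemma congX_sum (I : Type) (r : seq I) (F G : I -> {poly R}) M :
  (forall i, congX M (F i) (G i)) ->
  congX M (\sum_(i <- r) F i) (\sum_(i <- r) G i).
Proof.
move=> FG; elim/big_rec2: _ => [|i p q _ pq]; first exact: congX_refl.
exact: congXD.
Qed.

Lemma congX_mulXn M N k p q :
  (N <= k + M)%N -> congX M p q -> congX N ('X^k * p) ('X^k * q).
Proof.
move=> leN [r ->]; apply: (congX_le leN).
by exists r; rewrite mulrDr [in RHS]exprD; ring.
Qed.

(** Substituting a multiple of [X] is continuous for the [X]-adic topology; the
    form [s * 'X] covers both [q -> -q] and [q -> q^2]. *)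
Lemma congX_comp M s p q : congX M p q -> congX M (p \Po (s * 'X)) (q \Po (s * 'X)).
Proof.
case=> r ->; exists ((r \Po (s * 'X)) * s ^+ M).
by rewrite comp_polyD comp_polyM comp_Xn_poly exprMn mulrA.
Qed.

(** A polynomial with constant coefficient 1 is [1 - sX]; multiplying by the
    truncated geometric series [g] of its inverse turns it into
    [1 - (sX)^M], which is 1 modulo [X^M]. *)
Lemma congX_cancel M u p q : u.[0] = 1 -> congX M (u * p) (u * q) -> congX M p q.
Proof.
move=> u0 [r Er].
have /factor_theorem[s Es] : root (1 - u) 0.
  by rewrite /root hornerD hornerN hornerC u0 subrr.
have Eu : u = 1 - s * 'X by rewrite -[u in LHS](subKr 1) Es subr0.
have Eg := subrX1 (s * 'X) M.
set g := \sum_(i < M) _ in Eg.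
exists (r * g + (p - q) * s ^+ M).
have {}Er : u * (p - q) = r * 'X^M by rewrite mulrBr Er; ring.
have {}Eg : 1 - s ^+ M * 'X^M = u * g.
  by rewrite Eu -exprMn; apply: oppr_inj; rewrite opprB Eg; ring.
have -> : q + (r * g + (p - q) * s ^+ M) * 'X^M
   = q + (r * 'X^M) * g + (p - q) * (s ^+ M * 'X^M) by ring.
rewrite -Er -[s ^+ M * _](_ : 1 - (1 - s ^+ M * 'X^M) = _); last by ring.
by rewrite Eg; ring.
Qed.

Lemma congX_coef M p q i : (i < M)%N -> congX M p q -> p`_i = q`_i.
Proof. by move=> ltiM [r ->]; rewrite coefD coefMXn ltiM addr0. Qed.

Lemma coef_congX M p q : (forall i, (i < M)%N -> p`_i = q`_i) -> congX M p q.
Proof.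
move=> pq; exists (drop_poly M p - drop_poly M q).
rewrite -{1}[p](poly_take_drop M) -{1}[q](poly_take_drop M).
have -> : take_poly M p = take_poly M q.
  by apply/polyP => i; rewrite !coef_take_poly; case: ifP => // /pq.
by ring.
Qed.
End Congruence.

(** * The q-binomial theorem *)

Section QBinomial.
Local Open Scope ring_scope.
Variables (R : comNzRingType) (q : R).

(** The q-Pochhammer symbol [(q; q)_n]. *)
Definition qpoch n := \prod_(i < n) (1 - q ^+ i.+1).

(** The Gaussian binomial coefficient, by a Pascal rule, so that no division
    is needed in an arbitrary ring. *)
Fixpoint qbin m k : R :=
  match m, k with
  | _, 0 => 1
  | 0, _.+1 => 0
  | m'.+1, k'.+1 => qbin m' k'.+1 + q ^+ (m' - k') * qbin m' k'
  end.

Lemma qbin0 m : qbin m 0 = 1. Proof. by case: m. Qed.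

Lemma qbinS m k :
  qbin m.+1 k.+1 = qbin m k.+1 + q ^+ (m - k) * qbin m k.
Proof. by []. Qed.

Local Arguments qbin : simpl never.

Lemma qbin_small m k : (m < k)%N -> qbin m k = 0.
Proof.
elim: m k => [|m IHm] [|k] // ltmk.
by rewrite qbinS !IHm ?mulr0 ?addr0 // ltnW.
Qed.

Lemma qpochS n : qpoch n.+1 = qpoch n * (1 - q ^+ n.+1).
Proof. exact: big_ord_recr. Qed.

(** The factorial formula for Gaussian binomials; after multiplication by
    [(q; q)_l (q; q)_k] the Pascal rule becomes
    [(1 - q^l) + q^l (1 - q^k) = 1 - q^(k+l)]. *)
Lemma qbin_qpoch k l : qbin (k + l) k * qpoch k * qpoch l = qpoch (k + l).
Proof.
have [m] := ubnP (k + l); elim: m k l => // m IHm [|k] l.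
  by rewrite qbin0 /qpoch big_ord0 !mul1r.
case: l => [|l] ltm.
  have := IHm k 0%N; rewrite addn0 => /(_ ltac:(lia)) IH.
  rewrite addn0 qbinS qbin_small // subnn add0r mul1r qpochS -[in RHS]IH; ring.
have IH1 := IHm k.+1 l ltac:(lia); have IH2 := IHm k l.+1 ltac:(lia).
rewrite addnS addSn in IH1 *; rewrite addnS in IH2.
rewrite qbinS (_ : ((k + l).+1 - k = l.+1)%N); last by lia.
rewrite [in RHS]qpochS.
have -> : q ^+ (k + l).+2 = q ^+ l.+1 * q ^+ k.+1 by rewrite -exprD; congr (_ ^+ _); lia.
transitivity (qbin (k + l).+1 k.+1 * qpoch k.+1 * qpoch l * (1 - q ^+ l.+1)
  + q ^+ l.+1 * (qbin (k + l).+1 k * qpoch k * qpoch l.+1) * (1 - q ^+ k.+1)).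
  by rewrite !qpochS; ring.
by rewrite IH1 IH2; ring.
Qed.

Lemma q_binomial (x y : R) m :
  \prod_(i < m) (y + x * q ^+ i) =
    \sum_(j < m.+1) q ^+ 'C(j, 2) * qbin m j * x ^+ j * y ^+ (m - j).
Proof.
elim: m => [|m IHm].
  by rewrite big_ord0 big_ord_recr big_ord0 /= qbin0; ring.
rewrite big_ord_recr {}IHm [LHS]mulrC [LHS]mulrDl.
rewrite [X in y * X + _]big_ord_recl [in RHS]big_ord_recl bin0n !qbin0.
under [in RHS]eq_bigr => i _.
  rewrite lift0 subSS qbinS binS bin1 mulrDr !mulrDl.
  over.
rewrite big_split addrA.
congr (_ + _).
  rewrite [in RHS]big_ord_recr /= qbin_small // mulr0 !mul0r addr0.
  rewrite !subn0 mulrDr; congr (_ + _); first by rewrite exprS; ring.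
  rewrite mulr_sumr; apply: eq_bigr => i _; rewrite /bump /= add1n binS bin1.
  by rewrite -(subnSK (ltn_ord i)) [y ^+ _.+1]exprS; ring.
rewrite mulr_sumr; apply: eq_bigr => i _.
have -> : q ^+ m = q ^+ (m - i) * q ^+ i by rewrite -exprD subnK // -ltnS.
by rewrite exprD exprS; ring.
Qed.
End QBinomial.

(** * Finite forms of the triple product *)

Section Theta.
Local Open Scope ring_scope.

Local Notation Xpoly := {poly int}.

Lemma congX_prod_tail M (F : nat -> Xpoly) n m :
  (n <= m)%N -> (forall i, (n <= i)%N -> congX M (F i) 1) ->
  congX M (\prod_(i < m) F i) (\prod_(i < n) F i).
Proof.
move=> /subnKC <- F1; elim: (m - n)%N => [|k IHk].
  by rewrite addn0; apply: congX_refl.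
rewrite addnS big_ord_recr -[\prod_(i < n) _]mulr1.
by apply: congXM => //; apply/F1/leq_addr.
Qed.

Lemma congX_1DXn M k (c : Xpoly) : (M <= k)%N -> congX M (1 + c * 'X^k) 1.
Proof. by move=> leMk; exists (c * 'X^(k - M)); rewrite -mulrA -exprD subnK. Qed.

Definition odd_plus n : Xpoly := \prod_(i < n) (1 + 'X^(2 * i + 1)).
Definition odd_minus n : Xpoly := \prod_(i < n) (1 - 'X^(2 * i + 1)).
Definition even_plus n : Xpoly := \prod_(i < n) (1 + 'X^(2 * i + 2)).
Definition even_minus n : Xpoly := \prod_(i < n) (1 - 'X^(2 * i + 2)).

Lemma even_minusE n : even_minus n = qpoch 'X^2 n.
Proof. by apply: eq_bigr => i _; rewrite -exprM mulnS addnC. Qed.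

Lemma even_minus0 n : (even_minus n).[0] = 1.
Proof.
rewrite horner_prod big1 // => i _.
by rewrite !hornerE addnC expr0n subr0.
Qed.

Lemma even_minus_stable t n m :
  (t <= n)%N -> (t <= m)%N -> congX (2 * t + 2) (even_minus n) (even_minus m).
Proof.
have tail k : (t <= k)%N -> congX (2 * t + 2) (even_minus k) (even_minus t).
  move=> letk; apply: (@congX_prod_tail _ (fun i => 1 - 'X^(2 * i + 2))) => // i leti.
  by rewrite -mulN1r; apply: congX_1DXn; lia.
by move=> /tail tn /tail tm; apply: congX_trans tn (congX_sym tm).
Qed.

(** The limit of the Gaussian binomials: if [j] and [m - j] are at least [t],
    all q-factorials in [(Q; Q)_m / ((Q; Q)_j (Q; Q)_(m-j))], where [Q = X^2],
    agree with [E = (Q; Q)_n] up to order [Q^(t+1)], so the binomial is [1 / E]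
    to that order. *)
Lemma qbin_stable t n j m :
  (t <= n)%N -> (t <= j)%N -> (t + j <= m)%N ->
  congX (2 * t + 2) (even_minus n * qbin 'X^2 m j) 1.
Proof.
move=> letn letj letm; apply: (congX_cancel (even_minus0 n)); rewrite mulr1.
have mE : (m = j + (m - j))%N by lia.
have := qbin_qpoch ('X^2 : Xpoly) j (m - j); rewrite -mE -!even_minusE => Eq.
apply: (@congX_trans _ _ _ (even_minus m)); last by apply: even_minus_stable; lia.
rewrite -Eq mulrA mulrC mulrA.
apply: congXM; last by apply: even_minus_stable; lia.
by apply: congXM; [apply: congX_refl | apply: even_minus_stable; lia].
Qed.

Lemma bin2_sqr j : ('C(j, 2) * 2 + j = j * j)%N.
Proof. by elim: j => // j; rewrite binS bin1; lia. Qed.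

Lemma prodMXn n (f : 'I_n -> nat) (F G : 'I_n -> Xpoly) :
  (forall i, F i = 'X^(f i) * G i) ->
  \prod_(i < n) F i = 'X^(\sum_(i < n) f i) * \prod_(i < n) G i.
Proof. by move=> FG; rewrite (eq_bigr _ (fun i _ => FG i)) big_split /= prodrXr. Qed.

Lemma sum_odd n : (\sum_(i < n) (2 * i + 1) = n * n)%N.
Proof. by elim: n => [|n IHn]; rewrite ?big_ord0 // big_ord_recr /= IHn; lia. Qed.

Lemma sum_even n : (\sum_(i < n) 2 * i + n = n * n)%N.
Proof.
elim: n => [|n IHn]; first by rewrite big_ord0.
by rewrite big_ord_recr /= addnAC addnS IHn; lia.
Qed.

Lemma mulXn_inj k (p q : Xpoly) : 'X^k * p = 'X^k * q -> p = q.
Proof. by apply: mulfI; rewrite expf_neq0 // polyX_eq0. Qed.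

(** The q-binomial theorem with base [X^2] for the product of the [2n] factors
    [X^(2n) + X^(2i+1)].  Taking out the smaller power of [X] in each factor
    leaves every [1 + X^(2i+1)] with [i < n] twice, and completing the square
    in the exponents on the other side leaves [(n - j)^2].  As subtraction is
    truncated, [(n - j) + (j - n)] is the absolute difference. *)
Lemma finite_triple_odd n :
  odd_plus n ^+ 2 =
  \sum_(j < n + n.+1) 'X^(((n - j) + (j - n)) ^ 2) * qbin 'X^2 (n + n) j.
Proof.
(* The powers of X taken out are X^(2i+1) and X^(2n), each for all i < n. *)
apply: (@mulXn_inj (3 * n * n)); rewrite mulr_sumr addnS.
transitivity (\prod_(i < n + n) ('X^(2 * n) + 'X * 'X^2 ^+ i) : Xpoly).
  rewrite big_split_ord /=.
  have -> : \prod_(i < n) ('X^(2 * n) + 'X * 'X^2 ^+ i) = 'X^(n * n) * odd_plus n.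
    rewrite [odd_plus n](reindex_inj rev_ord_inj) -sum_odd.
    apply: prodMXn => i; rewrite /= mulrDr mulr1 -exprD -exprM -exprS addrC.
    by congr ('X^_ + 'X^_); have := ltn_ord i; lia.
  have -> : \prod_(i < n) ('X^(2 * n) + 'X * 'X^2 ^+ (n + i)) =
            'X^(2 * n * n) * odd_plus n.
    have <- : (\sum_(i < n) 2 * n = 2 * n * n)%N.
      by rewrite sum_nat_const card_ord mulnC.
    apply: prodMXn => i; rewrite mulrDr mulr1 -exprD -exprM -exprS.
    by congr (_ + 'X^_); lia.
  have -> : (3 * n * n = n * n + 2 * n * n)%N by lia.
  by rewrite exprD; ring.
rewrite q_binomial; apply: eq_bigr => -[j /= ltj] _.
rewrite mulrA -exprD -!exprM.
have -> (Q : Xpoly) a b c : 'X^a * Q * 'X^b * 'X^c = 'X^(a + b + c) * Q.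
  by rewrite !exprD; ring.
congr ('X^_ * _); have := bin2_sqr j.
have [/subnKC <-|/ltnW/subnKC <-] := leqP j n; rewrite !expnS expn0; nia.
Qed.

(** The same computation with the [2n+1] factors [X^(2n) + X^(2i)]; the middle
    one, [i = n], gives the 2 on the left.  The exponents on the right are
    [k(k+1)], each for [j = n - k] and for [j = n + 1 + k]. *)
Lemma finite_triple_even n :
  2 * even_plus n ^+ 2 =
  \sum_(j < n.+1 + n.+1)
     'X^(((n - j) + (j - n.+1)) * ((n - j) + (j - n.+1)).+1) * qbin 'X^2 (n + n.+1) j.
Proof.
(* The powers of X taken out are X^(2i) for i < n, and n + 1 times X^(2n). *)
apply: (@mulXn_inj (3 * n * n + n)); rewrite mulr_sumr addSn.
transitivity (\prod_(i < n + n.+1) ('X^(2 * n) + 1 * 'X^2 ^+ i) : Xpoly).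
  rewrite big_split_ord /=.
  have -> : \prod_(i < n) ('X^(2 * n) + 1 * 'X^2 ^+ i) =
            'X^(\sum_(i < n) 2 * i) * even_plus n :> Xpoly.
    rewrite [even_plus n](reindex_inj rev_ord_inj).
    apply: prodMXn => i; rewrite /= mulrDr mulr1 mul1r -exprD -exprM addrC.
    by congr ('X^_ + 'X^_); have := ltn_ord i; lia.
  have -> : \prod_(i < n.+1) ('X^(2 * n) + 1 * 'X^2 ^+ (n + i)) =
            'X^(2 * n * n.+1) * (2 * even_plus n) :> Xpoly.
    have <- : (\sum_(i < n.+1) 2 * n = 2 * n * n.+1)%N.
      by rewrite sum_nat_const card_ord mulnC.
    have -> : 2 * even_plus n = \prod_(i < n.+1) (1 + 'X^(2 * i)).
      rewrite big_ord_recl /= expr0; congr (_ * _).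
      by apply: eq_bigr => i _; rewrite /bump /= add1n; congr (_ + 'X^_); lia.
    apply: prodMXn => i.
    by rewrite mulrDr mulr1 mul1r -exprD -exprM mulnDr.
  have -> : (3 * n * n + n = \sum_(i < n) 2 * i + 2 * n * n.+1)%N.
    by have := sum_even n; lia.
  by rewrite exprD; ring.
rewrite q_binomial; apply: eq_bigr => -[j /= ltj] _.
rewrite expr1n mulr1 mulrA -exprD -!exprM.
have -> (Q : Xpoly) a b : 'X^a * Q * 'X^b = 'X^(a + b) * Q.
  by rewrite exprD; ring.
congr ('X^_ * _); have := bin2_sqr j.
have [/subnKC <-|/subnKC <-] := leqP j n; nia.
Qed.

(** Partial sums of the series of [q^(k^2)] over all integers [k]. *)
Definition theta n : Xpoly := 1 + 2 * \sum_(k < n) 'X^(k.+1 ^ 2).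
Definition oblong n : Xpoly := \sum_(k < n) 'X^(k * k.+1).

(** In [finite_triple_odd], the Gaussian binomial at distance [d] from the
    middle is [1 / E] up to order [2(n - d) + 2], and it comes with the factor
    [X^(d^2)]: the error has order at least [2n + 1 + (d - 1)^2]. *)
Lemma theta_product n :
  congX (2 * n + 1) (odd_plus n ^+ 2 * even_minus n) (theta n).
Proof.
have -> : theta n = \sum_(j < n + n.+1) 'X^(((n - j) + (j - n)) ^ 2).
  rewrite big_split_ord big_ord_recl /= (reindex_inj rev_ord_inj) /=.
  rewrite addn0 subnn expr0 addrCA; congr (1 + _).
  rewrite mulr2n mulrDl !mul1r; congr (_ + _); apply: eq_bigr => i _.
    by congr ('X^(_ ^ 2)); have := ltn_ord i; lia.
  by congr ('X^(_ ^ 2)); rewrite /bump /=; lia.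
rewrite mulrC finite_triple_odd mulr_sumr; apply: congX_sum => -[j /= ltj].
rewrite mulrCA -[X in congX _ _ X]mulr1; set d := (n - j + _)%N.
have le_dn : (d <= n)%N by rewrite /d; lia.
apply: (@congX_mulXn _ (2 * (n - d) + 2)).
  by rewrite -mulnn; move: d le_dn => d; nia.
by apply: qbin_stable; rewrite /d; lia.
Qed.

Lemma oblong_product n :
  congX (2 * n + 1) (2 * (even_plus n ^+ 2 * even_minus n)) (2 * oblong n.+1).
Proof.
have -> : 2 * oblong n.+1 =
    \sum_(j < n.+1 + n.+1) 'X^(((n - j) + (j - n.+1)) * ((n - j) + (j - n.+1)).+1).
  rewrite big_split_ord /= (reindex_inj rev_ord_inj) /=.
  rewrite mulr2n mulrDl !mul1r; congr (_ + _); apply: eq_bigr => i _.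
    by congr 'X^_; have := ltn_ord i; nia.
  by congr 'X^_; nia.
rewrite mulrA mulrC finite_triple_even mulr_sumr; apply: congX_sum => -[j /= ltj].
rewrite mulrCA -[X in congX _ _ X]mulr1; set d := (n - j + _)%N.
have le_dn : (d <= n)%N by rewrite /d; lia.
apply: (@congX_mulXn _ (2 * (n - d) + 2)); first by nia.
by apply: qbin_stable; rewrite /d; lia.
Qed.
End Theta.

(** * Theta functions and Jacobi's identity *)

Section Jacobi.
Local Open Scope ring_scope.

Local Notation Xpoly := {poly int}.

Local Instance congX_equivalence M : Equivalence (@congX int M).
Proof.
split; [exact: congX_refl | exact: congX_sym |].
by move=> p q r; apply: congX_trans.
Qed.

Local Instance congX_add_proper M :
  Proper (congX M ==> congX M ==> congX M) (+%R : Xpoly -> _).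
Proof. by move=> p q pq r s; apply: congXD. Qed.

Local Instance congX_opp_proper M : Proper (congX M ==> congX M) (-%R : Xpoly -> _).
Proof. by move=> p q; apply: congXN. Qed.

Local Instance congX_mul_proper M :
  Proper (congX M ==> congX M ==> congX M) ( *%R : Xpoly -> _).
Proof. by move=> p q pq r s; apply: congXM. Qed.

Local Instance congX_exp_proper M :
  Proper (congX M ==> eq ==> congX M) (@GRing.exp Xpoly).
Proof. by move=> p q pq k _ <-; apply: congX_exp. Qed.

(** The substitution [q -> q^2]. *)
Definition dilate (p : Xpoly) := p \Po 'X^2.
(** The substitution [q -> -q]. *)
Definition negX (p : Xpoly) := p \Po (- 'X).

Local Instance congX_dilate_proper M : Proper (congX M ==> congX M) dilate.
Proof. by move=> p q pq; apply: (congX_comp 'X). Qed.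

Local Instance congX_negX_proper M : Proper (congX M ==> congX M) negX.
Proof. by move=> p q pq; rewrite /negX -mulN1r; apply: congX_comp. Qed.

Lemma dilateD p q : dilate (p + q) = dilate p + dilate q. Proof. exact: rmorphD. Qed.
Lemma dilateN p : dilate (- p) = - dilate p. Proof. exact: rmorphN. Qed.
Lemma dilateM p q : dilate (p * q) = dilate p * dilate q. Proof. exact: rmorphM. Qed.
Lemma dilate_exp p k : dilate (p ^+ k) = dilate p ^+ k. Proof. exact: rmorphXn. Qed.
Lemma dilate_nat k : dilate k%:R = k%:R.
Proof. exact: (rmorph_nat (comp_poly 'X^2)). Qed.
Lemma dilate_sum n (F : nat -> Xpoly) : dilate (\sum_(k < n) F k) = \sum_(k < n) dilate (F k).
Proof. exact: (raddf_sum (comp_poly 'X^2)). Qed.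
Lemma negXD p q : negX (p + q) = negX p + negX q. Proof. exact: rmorphD. Qed.
Lemma negXM p q : negX (p * q) = negX p * negX q. Proof. exact: rmorphM. Qed.
Lemma negX_nat k : negX k%:R = k%:R.
Proof. exact: (rmorph_nat (comp_poly (- 'X))). Qed.
Lemma dilateXn k : dilate 'X^k = 'X^(2 * k).
Proof. by rewrite /dilate comp_Xn_poly -exprM. Qed.

Lemma negX_Xn k : negX 'X^k = (-1) ^+ k * 'X^k.
Proof. by rewrite /negX comp_Xn_poly [LHS]exprNn. Qed.

Lemma big_ord_pairs (T : Type) (idx : T) (op : Monoid.law idx) n (F : nat -> T) :
  \big[op/idx]_(k < n + n) F k =
  \big[op/idx]_(k < n) op (F (2 * k)%N) (F (2 * k + 1)%N).
Proof.
elim: n => [|n IHn]; first by rewrite !big_ord0.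
rewrite addnS addSn !big_ord_recr /= IHn Monoid.mulmA.
by congr (op (op _ (F _)) (F _)); lia.
Qed.

Lemma negX_Xn_odd k : odd k -> negX 'X^k = - 'X^k.
Proof. by move=> k_odd; rewrite negX_Xn -signr_odd k_odd expr1 mulN1r. Qed.

Lemma negX_Xn_even k : ~~ odd k -> negX 'X^k = 'X^k.
Proof. by move=> /negbTE k_even; rewrite negX_Xn -signr_odd k_even mul1r. Qed.

(** The squares of even integers are [4 k^2], and those of odd integers are
    [4 k(k+1) + 1]. *)
Lemma theta_pairs n :
  theta (n + n) = dilate (dilate (theta n)) + 2 * 'X * dilate (dilate (oblong n)).
Proof.
rewrite /theta /oblong (big_ord_pairs _ _ (fun k => 'X^(k.+1 ^ 2))) big_split /=.
rewrite !(dilateD, dilateM, dilate_nat 1, dilate_nat 2, dilate_sum n (fun k => 'X^(k * k.+1)),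
  dilate_sum n (fun k => 'X^(k.+1 ^ 2)), dilate_sum n (fun k => dilate 'X^(k * k.+1)),
  dilate_sum n (fun k => dilate 'X^(k.+1 ^ 2))).
set S := \sum_(i < n) dilate (dilate 'X^(i.+1 ^ 2)).
set T := \sum_(i < n) dilate (dilate _).
have -> : \sum_(i < n) 'X^((2 * i).+1 ^ 2) = 'X * T.
  rewrite mulr_sumr; apply: eq_bigr => i _.
  by rewrite !dilateXn -exprS; congr 'X^_; rewrite -!mulnn; lia.
have -> : \sum_(i < n) 'X^((2 * i + 1).+1 ^ 2) = S.
  by apply: eq_bigr => i _; rewrite !dilateXn; congr 'X^_; rewrite -!mulnn; lia.
by ring.
Qed.

Lemma negX_dilate p : negX (dilate p) = dilate p.
Proof. by rewrite /negX /dilate -comp_polyA comp_Xn_poly sqrrN. Qed.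

(** Comparing coefficients, [p_k] is 0 or [-2 p_(k/2)]: this kills [p_0], and
    then all coefficients by strong induction. *)
Lemma congX_dilate_eigen M p : congX M p (- 2 * dilate p) -> congX M p 0.
Proof.
move=> Ep; apply: coef_congX => k; rewrite coef0.
elim/ltn_ind: k => k IHk ltkM; rewrite (congX_coef ltkM Ep).
rewrite mulNr mulr_natl coefN coefMn /dilate coef_comp_poly_Xn //.
case: ifP => _; last by rewrite mul0rn oppr0.
case: k => [|k] in IHk ltkM *; last by rewrite IHk ?mul0rn ?oppr0 //; lia.
have := congX_coef ltkM Ep.
rewrite mulNr mulr_natl coefN coefMn /dilate coef_comp_poly_Xn // dvdn0 div0n.
by move: p`_0 => c; lia.
Qed.

(** The partial products of [phi(q)], [phi(-q)] and [psi(q^2)], in Ramanujan's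
    notation. *)
Definition phi_prod n := odd_plus n ^+ 2 * even_minus n.
Definition phim_prod n := odd_minus n ^+ 2 * even_minus n.
Definition psi_prod n := even_plus n ^+ 2 * even_minus n.

Section Products.
Variable M : nat.
Local Notation "p =X q" := (congX M p q) (at level 70).
Local Notation A := (odd_plus M).
Local Notation B := (odd_minus M).
Local Notation C := (even_plus M).
Local Notation E := (even_minus M).
Local Notation phi := (phi_prod M).
Local Notation phim := (phim_prod M).
Local Notation psi := (psi_prod M).

Lemma odd_plus_stable n m : (M <= n)%N -> (M <= m)%N -> odd_plus n =X odd_plus m.
Proof.
have tail k : (M <= k)%N -> odd_plus k =X A.
  move=> leMk; apply: (@congX_prod_tail _ (fun i => 1 + 'X^(2 * i + 1))) => // i leMi.
  by rewrite -['X^_]mul1r; apply: congX_1DXn; lia.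
by move=> /tail -> /tail ->; reflexivity.
Qed.

Lemma even_plus_stable n m : (M <= n)%N -> (M <= m)%N -> even_plus n =X even_plus m.
Proof.
have tail k : (M <= k)%N -> even_plus k =X C.
  move=> leMk; apply: (@congX_prod_tail _ (fun i => 1 + 'X^(2 * i + 2))) => // i leMi.
  by rewrite -['X^_]mul1r; apply: congX_1DXn; lia.
by move=> /tail -> /tail ->; reflexivity.
Qed.

Lemma even_minus_stableM n m : (M <= n)%N -> (M <= m)%N -> even_minus n =X even_minus m.
Proof.
by move=> len lem; apply: congX_le (even_minus_stable len lem); lia.
Qed.

Lemma theta_stable n : (M <= n)%N -> theta n =X phi.
Proof.
move=> leMn; have /(congX_le (N := M)) <- := theta_product n; last by lia.
by rewrite (odd_plus_stable leMn (leqnn M)) (even_minus_stableM leMn (leqnn M)); reflexivity.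
Qed.

Lemma oblong_stable n : (M < n)%N -> 2 * oblong n =X 2 * psi.
Proof.
case: n => // n leMn; have /(congX_le (N := M)) <- := oblong_product n; last by lia.
by rewrite (even_plus_stable leMn (leqnn M)) (even_minus_stableM leMn (leqnn M)); reflexivity.
Qed.

Lemma negX_phi : negX phi = phim.
Proof.
rewrite /negX rmorphM rmorphXn /= !rmorph_prod; congr (_ ^+ 2 * _).
  by apply: eq_bigr => i _; rewrite rmorphD rmorph1; congr (1 + _); apply: negX_Xn_odd; lia.
by apply: eq_bigr => i _; rewrite rmorphB rmorph1; congr (1 - _); apply: negX_Xn_even; lia.
Qed.

Lemma phi_expansion : phi =X dilate (dilate phi) + 2 * 'X * dilate (dilate psi).
Proof.
have twice p : 2 * 'X * dilate (dilate p) = 'X * dilate (dilate (2 * p)).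
  by rewrite !dilateM !dilate_nat; ring.
(* The index exceeds M because n terms of the oblong series match the product
   of n - 1 factors. *)
transitivity (theta (M.+1 + M.+1)); first by symmetry; apply: theta_stable; lia.
rewrite theta_pairs !twice (theta_stable (leqnSn M)) (oblong_stable (ltnSn M)).
reflexivity.
Qed.

(** The expansion [phi_expansion] under [q -> -q], which fixes all series in
    [q^4]. *)
Lemma phim_expansion : phim =X dilate (dilate phi) - 2 * 'X * dilate (dilate psi).
Proof.
rewrite -negX_phi {1}phi_expansion negXD !negXM negX_nat !negX_dilate (@negX_Xn_odd 1) //.
by rewrite mulrN mulNr; reflexivity.
Qed.

Lemma dilate_odd_minus : dilate B = A * B.
Proof.
rewrite /dilate rmorph_prod -big_split /=; apply: eq_bigr => i _.
by rewrite rmorphB rmorph1 /= comp_Xn_poly -exprM mulnC exprM; ring.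
Qed.

Lemma dilate_even_minus : dilate E = C * E.
Proof.
rewrite /dilate rmorph_prod -big_split /=; apply: eq_bigr => i _.
by rewrite rmorphB rmorph1 /= comp_Xn_poly -exprM mulnC exprM; ring.
Qed.

Lemma even_minus_pairs : even_minus (M + M) = dilate B * dilate E.
Proof.
rewrite /even_minus (big_ord_pairs _ _ (fun i => 1 - 'X^(2 * i + 2))) big_split /=.
rewrite /dilate !rmorph_prod; congr (_ * _); apply: eq_bigr => i _;
  by rewrite rmorphB rmorph1 /= comp_Xn_poly -exprM; congr (_ - 'X^_); lia.
Qed.

Lemma even_plus_pairs : even_plus (M + M) = dilate A * dilate C.
Proof.
rewrite /even_plus (big_ord_pairs _ _ (fun i => 1 + 'X^(2 * i + 2))) big_split /=.
rewrite /dilate !rmorph_prod; congr (_ * _); apply: eq_bigr => i _;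
  by rewrite rmorphD rmorph1 /= comp_Xn_poly -exprM; congr (_ + 'X^_); lia.
Qed.

(** Multiplied by [E], the product becomes that of all [1 - q^(4i+2)] and
    [1 - q^(4i+4)], which is [E] again. *)
Lemma euler_product : A * B * C =X 1.
Proof.
apply: (congX_cancel (even_minus0 M)); rewrite mulr1.
have -> : E * (A * B * C) = dilate B * dilate E.
  by rewrite dilate_odd_minus dilate_even_minus; ring.
by rewrite -even_minus_pairs; apply: even_minus_stableM; lia.
Qed.

(** Both sides differ by [(A B C)^2], since [B] and [E] at [q^2] are [A B] and
    [C E]. *)
Lemma phi_phim : phi * phim =X dilate phim ^+ 2.
Proof.
have -> : dilate phim ^+ 2 = (A * B * C) ^+ 2 * (phi * phim).
  rewrite dilateM dilate_exp dilate_odd_minus dilate_even_minus.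
  by rewrite /phi_prod /phim_prod; ring.
by rewrite euler_product expr1n mul1r; reflexivity.
Qed.

(** The products [A] and [C] taken at [q^2] multiply to [C], by splitting the
    even exponents modulo 4. *)
Lemma dilate_phi_psi : dilate phi * dilate psi =X psi ^+ 2.
Proof.
have -> : dilate phi * dilate psi = even_plus (M + M) ^+ 2 * (C * E) ^+ 2.
  by rewrite even_plus_pairs !dilateM ?dilate_exp dilate_even_minus; ring.
rewrite (even_plus_stable (leq_addr M M) (leqnn M)) /psi_prod.
have -> : C ^+ 2 * (C * E) ^+ 2 = (C ^+ 2 * E) ^+ 2 by ring.
reflexivity.
Qed.

Lemma phiD : phi + phim =X 2 * dilate (dilate phi).
Proof.
rewrite {1}phi_expansion phim_expansion.
by rewrite [X in congX _ X](_ : _ = 2 * dilate (dilate phi)); [reflexivity | ring].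
Qed.

Lemma phiB : phi - phim =X 4 * 'X * dilate (dilate psi).
Proof.
rewrite {1}phi_expansion phim_expansion.
by rewrite [X in congX _ X](_ : _ = 4 * 'X * dilate (dilate psi)); [reflexivity | ring].
Qed.

(** The difference [D] of the two sides satisfies [D(q) = -2 D(q^2)]: rewrite
    [phi(q)^2 + phi(-q)^2] as [(phi(q) + phi(-q))^2 - 2 phi(q) phi(-q)], that
    is, [4 phi(q^4)^2 - 2 phi(-q^2)^2]. *)
Lemma phi_sqrD : phi ^+ 2 + phim ^+ 2 =X 2 * dilate phi ^+ 2.
Proof.
pose D := phi ^+ 2 + phim ^+ 2 - 2 * dilate phi ^+ 2.
have D0 : D =X 0.
  apply: congX_dilate_eigen.
  have -> : dilate D = dilate phi ^+ 2 + dilate phim ^+ 2 - 2 * dilate (dilate phi) ^+ 2.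
    by rewrite /D !dilateD dilateN (dilateM 2) dilate_nat -!dilate_exp.
  have -> : D = (phi + phim) ^+ 2 - 2 * (phi * phim) - 2 * dilate phi ^+ 2.
    by rewrite /D; ring.
  rewrite phiD phi_phim.
  set x := dilate (dilate _); set y := dilate _; set z := dilate _.
  rewrite [X in congX _ X](_ : _ = - 2 * (z ^+ 2 + y ^+ 2 - 2 * x ^+ 2)).
    reflexivity.
  by ring.
rewrite -[X in congX _ X](subrK (2 * dilate phi ^+ 2)) -/D D0 add0r; reflexivity.
Qed.

(** Times [E^4], this is [phi(q)^4 - phi(-q)^4 = 16 q psi(q^2)^4].  Factoring
    the left-hand side produces [16 q phi(q^2)^2 phi(q^4) psi(q^8)], which
    [dilate_phi_psi], applied at [q^2] and then at [q], turns into the right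
    one. *)
Lemma jacobi_aequatio : A ^+ 8 =X B ^+ 8 + 16 * 'X * C ^+ 8.
Proof.
have E4 : (E ^+ 4).[0] = 1 by rewrite horner_exp even_minus0 expr1n.
apply: (congX_cancel E4).
have -> : E ^+ 4 * A ^+ 8 =
    phim ^+ 4 + (phi ^+ 2 + phim ^+ 2) * ((phi + phim) * (phi - phim)).
  by rewrite /phi_prod /phim_prod; ring.
rewrite phi_sqrD phiD phiB.
have -> : 2 * dilate phi ^+ 2 * (2 * dilate (dilate phi) * (4 * 'X * dilate (dilate psi))) =
   16 * 'X * dilate phi ^+ 2 * dilate (dilate phi * dilate psi) by rewrite dilateM; ring.
rewrite dilate_phi_psi.
have -> : 16 * 'X * dilate phi ^+ 2 * dilate (psi ^+ 2) =
   16 * 'X * (dilate phi * dilate psi) ^+ 2 by rewrite dilate_exp; ring.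
rewrite dilate_phi_psi /phim_prod /psi_prod.
rewrite [X in congX _ X](_ : _ = E ^+ 4 * (B ^+ 8 + 16 * 'X * C ^+ 8)).
  reflexivity.
by ring.
Qed.

(** The cube of [jacobi_aequatio]; the cross term is [48 q (A B C)^8]. *)
Lemma product_identity :
  A ^+ 24 - B ^+ 24 =X 48 * 'X + 4096 * 'X^3 * C ^+ 24.
Proof.
have -> : A ^+ 24 = (A ^+ 8) ^+ 3 by rewrite -exprM.
have ABC8 : A ^+ 8 * B ^+ 8 * C ^+ 8 =X 1.
  by rewrite -!exprMn euler_product expr1n; reflexivity.
have step : (B ^+ 8 + 16 * 'X * C ^+ 8) ^+ 3 - B ^+ 24 =
    48 * 'X * ((B ^+ 8 + 16 * 'X * C ^+ 8) * B ^+ 8 * C ^+ 8) + 4096 * 'X^3 * C ^+ 24.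
  by ring.
by rewrite jacobi_aequatio step -jacobi_aequatio ABC8 mulr1; reflexivity.
Qed.
End Products.
End Jacobi.

(** * Counting colored partitions *)

Section SubsetGeneratingFunction.
Local Open Scope ring_scope.
Variables (T : finType) (w : T -> nat).

Lemma coef_prod_1DXn (c : int) N :
  (\prod_(t : T) (1 + c *: 'X^(w t)))`_N =
  \sum_(J : {set T} | (\sum_(t in J) w t == N)%N) c ^+ #|J|.
Proof.
under eq_bigr => t _ do rewrite addrC.
rewrite bigA_distr coef_sum big_mkcond [RHS]big_mkcond /=; apply: eq_bigr => J _.
rewrite -big_mkcond /= (eq_bigr (fun t => c%:P * 'X^(w t))); last first.
  by move=> t _; rewrite mul_polyC.
rewrite big_split /= prodr_const prodrXr -rmorphXn /= mul_polyC coefZ coefXn eq_sym.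
by case: eqP => _; rewrite (mulr1, mulr0).
Qed.

Lemma coef_prod_plus N :
  (\prod_(t : T) (1 + 'X^(w t)) : {poly int})`_N =
  #|[set J : {set T} | (\sum_(t in J) w t == N)%N]|%:R.
Proof.
under eq_bigr => t _ do rewrite -['X^_]scale1r.
rewrite coef_prod_1DXn (eq_bigr (fun=> 1)) => [|J _]; last by rewrite expr1n.
by rewrite sumr_const; congr (_ *+ _); apply: eq_card => J; rewrite inE.
Qed.

(** Changing the signs of the factors weights a subset [J] by [(-1)^#|J|]. *)
Lemma coef_prod_plus_minus N :
  (\prod_(t : T) (1 + 'X^(w t)) - \prod_(t : T) (1 - 'X^(w t)) : {poly int})`_N =
  2 * #|[set J : {set T} | (\sum_(t in J) w t == N)%N && odd #|J|]|%:R.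
Proof.
under eq_bigr => t _ do rewrite -['X^_]scale1r.
under [X in _ - X]eq_bigr => t _ do rewrite -scaleN1r.
rewrite coefB !coef_prod_1DXn -sumrB.
rewrite -sum1dep_card natr_sum mulr_sumr [RHS]big_mkcondr /=.
apply: eq_bigr => J _; rewrite expr1n -signr_odd.
by case: (odd _); rewrite ?mulr1 // subrr.
Qed.
End SubsetGeneratingFunction.

Section ColoredPartitions.

(** Elements with value above [N] cannot occur in a partition of [N], so the
    finite type [T] needs to enumerate only the others: the partitions are then
    the images under [g] of subsets of [T]. *)
Lemma card_distinct_partitions (T : finType) (g : T -> colored_nat)
    (X : set colored_nat) (N : nat) (Q : pred nat) :
  injective g -> (forall t, X (g t)) ->
  (forall x, X x -> x.2 <= N -> exists t, x = g t) ->
  #|` fset_set [set A | distinct_partitions X N A /\ Q #|` A|]%classic| =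
  #|[set J : {set T} | (\sum_(t in J) (g t).2 == N) && Q #|J|]|.
Proof.
move=> g_inj gX Xg; set S := [set J | _].
pose F (J : {set T}) := seq_fset tt [seq g t | t <- enum J].
have uniqJ (J : {set T}) : uniq [seq g t | t <- enum J].
  by rewrite map_inj_uniq // enum_uniq.
have memF J t : (g t \in F J) = (t \in J).
  by rewrite seq_fsetE mem_map // mem_enum.
have F_inj : injective F.
  by move=> J K FJK; apply/setP => t; rewrite -!memF FJK.
have sumF J : \sum_(x <- F J) x.2 = \sum_(t in J) (g t).2.
  by rewrite (perm_big _ (seq_fset_perm _ _)) undup_id //= big_map big_enum.
have cardF J : #|` F J| = #|J|.
  by rewrite size_seq_fset undup_id // size_map cardE.
pose FS := seq_fset tt [seq F J | J <- enum S].
have memFS A : (A \in FS) = (A \in [seq F J | J <- enum S]) by exact: seq_fsetE.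
have -> : [set A | distinct_partitions X N A /\ Q #|` A|]%classic = [set` FS]%classic.
  apply/seteqP; split=> A /=; rewrite memFS.
    move=> [[AX sumA] QA].
    have AE : A = F [set t | g t \in A].
      apply/fsetP => x; apply/idP/idP => [xA|].
        have [t xgt] : exists t, x = g t.
          apply: Xg; first exact: AX.
          by rewrite -sumA (big_fsetD1 _ xA) /= leq_addr.
        by rewrite xgt memF inE -xgt.
      by rewrite seq_fsetE => /mapP[t]; rewrite mem_enum inE => ? ->.
    apply/mapP; exists [set t | g t \in A] => //.
    by rewrite mem_enum inE -sumF -cardF -AE sumA eqxx.
  move=> /mapP[J]; rewrite mem_enum inE => /andP[/eqP sumJ QJ] ->.
  rewrite cardF; split=> //; split; last by rewrite sumF.
  by move=> x /=; rewrite seq_fsetE => /mapP[t _ ->].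
rewrite set_fsetK size_seq_fset undup_id ?size_map -?cardE //.
by rewrite map_inj_uniq // enum_uniq.
Qed.

Variable N : nat.

Let odd_copy (t : 'I_24 * 'I_N.+1) : colored_nat := (t.1, 2 * t.2 + 1).
Let even_copy (t : 'I_24 * 'I_N.+1) : colored_nat := (t.1, 2 * t.2 + 2).

Lemma D_S_card :
  D_S N = #|[set J : {set 'I_24 * 'I_N.+1} |
             (\sum_(t in J) (2 * t.2 + 1) == N) && odd #|J|]|.
Proof.
apply: (card_distinct_partitions (g := odd_copy)) => [[c i] [d j] | t | [c v]] /=.
- by move=> [-> ij]; congr (_, _); apply: val_inj => /=; lia.
- by rewrite /odd_copies /=; lia.
rewrite /odd_copies /= => v_odd leN.
have ltv : v./2 < N.+1 by lia.
by exists (c, Ordinal ltv); congr (_, _) => /=; lia.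
Qed.

Lemma D_T_card n : n <= N ->
  D_T n = #|[set J : {set 'I_24 * 'I_N.+1} | \sum_(t in J) (2 * t.2 + 2) == n]|.
Proof.
move=> leN; rewrite /D_T.
have -> : distinct_partitions even_copies n =
    [set A | distinct_partitions even_copies n A /\ predT #|` A|]%classic.
  by apply/seteqP; split=> A //= -[].
rewrite (card_distinct_partitions (g := even_copy)) => [|[c i] [d j] | t | [c v]] /=.
- by apply: eq_card => J; rewrite !inE andbT.
- by move=> [-> ij]; congr (_, _); apply: val_inj => /=; lia.
- by rewrite /even_copies /=; split; lia.
rewrite /even_copies /= => -[v_gt0 v_even] lev.
have ltv : v./2.-1 < N.+1 by lia.
by exists (c, Ordinal ltv); congr (_, _) => /=; lia.
Qed.

Local Open Scope ring_scope.

Lemma prod_colors m (F : nat -> {poly int}) :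
  \prod_(t : 'I_24 * 'I_m) F t.2 = (\prod_(i < m) F i) ^+ 24.
Proof.
rewrite -(pair_bigA _ (fun (_ : 'I_24) (i : 'I_m) => F i)) /=.
by rewrite prodr_const card_ord.
Qed.

Lemma coef_D_S : (odd_plus N.+1 ^+ 24 - odd_minus N.+1 ^+ 24)`_N = 2 * (D_S N)%:R.
Proof.
rewrite /odd_plus /odd_minus D_S_card.
rewrite -(prod_colors _ (fun i => 1 + 'X^(2 * i + 1))).
rewrite -(prod_colors _ (fun i => 1 - 'X^(2 * i + 1))).
exact: (coef_prod_plus_minus (fun t : 'I_24 * 'I_N.+1 => 2 * t.2 + 1)%N).
Qed.

Lemma coef_D_T n : (n <= N)%N -> (even_plus N.+1 ^+ 24)`_n = (D_T n)%:R.
Proof.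
move=> leN; rewrite (D_T_card leN) /even_plus.
rewrite -(prod_colors _ (fun i => 1 + 'X^(2 * i + 2))).
exact: (coef_prod_plus (fun t : 'I_24 * 'I_N.+1 => 2 * t.2 + 2)%N).
Qed.
End ColoredPartitions.

Theorem theorem3p2 (N : nat) (hN : 3 <= N) : D_S N = 2048 * D_T (N - 3).
Proof.
have := congX_coef (ltnSn N) (product_identity N.+1).
rewrite coef_D_S coefD -['X%R]expr1 !(mulr_natl, coefMn, coefXn, mulrnAl, coefXnM).
rewrite coef_D_T; last by lia.
rewrite ltnNge hN /= (_ : N == 1 = false); last by lia.
by lia.
Qed.
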